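(* Let $G'$ be a noncompact connected real inner form of a linear complex semisimple orthogonal group $G^{\mathbb{C}}$ of type $B_m$ or $D_m$, let $H'$ be the stabilizer in $G'$ of the first coordinate vector, and let $\psi_1:G'/H'\to\mathbb{C}$ be the matrix coefficient $\psi_1(g)=\langle\pi_1(g)v_0,v_1\rangle$, where $\pi_1$ is the irreducible finite-dimensional representation of $G'$ with highest weight $(1,0,\ldots,0)$, $v_0$ is an $H'$-invariant unit vector and $v_1$ is a unit highest weight vector of $\pi_1$. Let $\mathscr{D}=\{x^{(i)}\in G'/H': 1\leq i\leq n\}$ be a set of rational points and let $f:\mathscr{D}\to\mathbb{Q}$ be a nonconstant function. Suppose that $\psi_1(x^{(i)})\neq 0$ for all $1\leq i\leq n$ and $\psi_1(x^{(i)})\neq\psi_1(x^{(j)})$ for all $1\leq i<j\leq n$. Then there are coefficients $a_1,\ldots,a_n$, algebraic over $\mathbb{Q}$, such that $$W_{f,\mathscr{D}}(x)=\sum_{\ell=1}^n a_\ell\,\psi_1(x)^\ell$$ satisfies $W_{f,\mathscr{D}}(x)=f(x)$ for all $x\in\mathscr{D}$.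
   Context: $G^{\mathbb{C}}$ is $\mathrm{SO}(N,\mathbb{C})$ with $N=2m+1$ (type $B_m$) or $N=2m$ (type $D_m$), with maximal compact subgroup $K_0=\mathrm{SO}(N)$ and a maximal torus $T_0$ of $K_0$ (the standard one, consisting of rotations in the coordinate planes $(1,2),(3,4),\ldots$); highest weights are taken with respect to the Cartan subgroup centralizing $T_0$, in Bourbaki's conventions. The irreducible representation with highest weight $(1,0,\ldots,0)$ is the standard representation on $\mathbb{C}^N$. $G'/H'$ is viewed as the $G'$-orbit of the first coordinate vector; a rational point is one whose coordinates in this realization are rational. The function $\psi_1$ on $G'$ is right $H'$-invariant and hence a function on $G'/H'$; its powers $\psi_1^b$ are the highest weight vectors of the finite-dimensional spherical representations with highest weight $(b,0,\ldots,0)$ realized in $C^\infty(G'/H')$.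
   Formalization: The unit vectors v_0 and v_1 are assumed to have algebraic coordinates (a transcendental phase makes the claim false), and v_0 is assumed to be a scalar multiple of the first coordinate vector, which is automatic for SO(p,q)_0 in its usual position but not for SO*(2m). *)

(* Defs.v *)
From HB Require Import structures.
From mathcomp Require Import all_boot all_order all_algebra.
From mathcomp Require Import complex.
From mathcomp Require Import all_classical all_reals all_analysis.

Set Implicit Arguments.
Unset Strict Implicit.
Unset Printing Implicit Defensive.

Import Order.TTheory GRing.Theory Num.Theory.
Import numFieldNormedType.Exports.
Local Open Scope classical_set_scope.
Local Open Scope ring_scope.

(* R[i] carries no topology of its own; seen as a numClosedFieldType it gets
   the one induced by its norm, and matrices over it the product topology. *)
Definition Cplx (R : realType) : numClosedFieldType := R[i].

Definition algebraic (R : realType) (z : Cplx R) : Prop :=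
  algebraicOver (ratr : rat -> Cplx R) z.

Definition hdot (R : realType) (N : nat) (v w : 'cV[Cplx R]_N) : Cplx R :=
  \sum_j v j 0 * (w j 0)^*.

Definition unit_vector (R : realType) (N : nat) (v : 'cV[Cplx R]_N) : Prop :=
  hdot v v = 1.

Definition e1 (R : realType) (N : nat) : 'cV[Cplx R]_N :=
  \col_(j < N) ((j == 0 :> nat)%:R).

Definition SO_C (R : realType) (N : nat) : set 'M[Cplx R]_N :=
  [set g | g^T *m g = 1%:M /\ \det g = 1].

(* Complex conjugation is the antiholomorphic involution of SO(N, C) whose
   fixed group is the compact form SO(N); conj_by t is its composite with the
   inner automorphism Ad t. *)
Definition conj_by (R : realType) (N : nat) (t g : 'M[Cplx R]_N)
    : 'M[Cplx R]_N :=
  t *m map_mx Num.conj g *m invmx t.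

Definition inner_real_structure (R : realType) (N : nat)
    (t : 'M[Cplx R]_N) : Prop :=
  SO_C t /\
  (forall g, SO_C g -> conj_by t (conj_by t g) = g).

(* Up to conjugation and apart from SO(N) itself, these are SO(p,q)_0 for every
   p + q = N when N is odd; SO(p,q)_0 with p, q even and SO*(N) when N is even. *)
Definition connected_real_inner_form (R : realType) (N : nat)
    (G : set 'M[Cplx R]_N) : Prop :=
  exists2 t, inner_real_structure t &
    G = connected_component (@SO_C R N `&` [set g | conj_by t g = g]) 1%:M.

Definition stab_e1 (R : realType) (N : nat) (G : set 'M[Cplx R]_N)
    : set 'M[Cplx R]_N :=
  G `&` [set h | h *m e1 R N = e1 R N].

(* G/H, for H := stab_e1 G. *)
Definition orbit_e1 (R : realType) (N : nat) (G : set 'M[Cplx R]_N)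
    : set 'cV[Cplx R]_N :=
  [set g *m e1 R N | g in G].

(* Inside SO(N, C) the group SO(p,q)_0 does not consist of real matrices: its
   usual real realization, on a hyperboloid of R^N, is the one in the basis
   'i ^+ u j *: e_j, where u flags the coordinates whose sign in the quadratic
   form is opposite to that of the first one. For u = 0 these are the plain
   coordinates of C^N. *)
Definition realization (N : nat) (u : 'I_N -> bool) : Prop :=
  forall j : 'I_N, j = 0 :> nat -> u j = false.

Definition rational_point (R : realType) (N : nat) (u : 'I_N -> bool)
    (x : 'cV[Cplx R]_N) : Prop :=
  forall j, exists q : rat, x j 0 = 'i ^+ (u j) * ratr q.

(* -'i times the infinitesimal rotation in the k-th coordinate plane; it acts
   on that plane with eigenvalues 1 and -1. *)
Definition rotation_generator (R : realType) (N : nat) (k : 'I_N./2)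
    : 'M[Cplx R]_N :=
  \matrix_(i < N, j < N)
    ('i * ((i == k.*2 :> nat) && (j == k.*2.+1 :> nat))%:R
     - 'i * ((i == k.*2.+1 :> nat) && (j == k.*2 :> nat))%:R).

Definition cartan (R : realType) (N : nat) (a : 'I_N./2 -> Cplx R)
    : 'M[Cplx R]_N :=
  \sum_k a k *: rotation_generator R k.

(* Integral weights, in coordinates on the basis (epsilon_k), where epsilon_k
   sends cartan a to a k. *)
Definition weight (N : nat) : Type := 'I_N./2 -> int.

Definition weight_eval (R : realType) (N : nat) (la : weight N)
    (a : 'I_N./2 -> Cplx R) : Cplx R :=
  \sum_k (la k)%:~R * a k.

Definition epsilon (N : nat) (k : 'I_N./2) : weight N := fun l => (l == k)%:R.

(* Types B (N odd) and D (N even), with Bourbaki's choice of positive roots. *)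
Definition positive_root (N : nat) (al : weight N) : Prop :=
  (exists i j : 'I_N./2, (i < j)%N /\
     (al =1 epsilon i \- epsilon j \/ al =1 epsilon i \+ epsilon j))
  \/ (odd N /\ exists i : 'I_N./2, al =1 epsilon i).

Definition root_vector (R : realType) (N : nat) (al : weight N)
    (X : 'M[Cplx R]_N) : Prop :=
  X^T = - X /\
  (forall a, cartan a *m X - X *m cartan a = weight_eval al a *: X).

(* For the standard representation on C^N. *)
Definition highest_weight_vector (R : realType) (N : nat) (la : weight N)
    (v : 'cV[Cplx R]_N) : Prop :=
  [/\ v != 0,
      forall a, cartan a *m v = weight_eval la a *: v &
      forall al X, positive_root al -> root_vector al X -> X *m v = 0].

Definition first_fundamental_weight (N : nat) : weight N :=
  fun k => (k == 0 :> nat)%:R.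

(* Main.v *)
Require Import Defs.
From HB Require Import structures.
From mathcomp Require Import all_boot all_order all_algebra.
From mathcomp Require Import complex.
From mathcomp Require Import all_classical all_reals all_analysis.

Import Order.TTheory GRing.Theory Num.Theory.
Import numFieldNormedType.Exports.
Local Open Scope classical_set_scope.
Local Open Scope ring_scope.

(** As v0 = c e1, the function psi1 is the linear form
    x |-> c <x, v1>.  Since v0, v1 and the points are algebraic, so are the
    values of psi1, and Lagrange interpolation of f / psi1 at these distinct
    nonzero values has algebraic coefficients. *)

(** Boolean form of [algebraic], so that closure properties can be registered and the [rpred] lemmas
    apply. *)
Definition algebraic_pred (R : realType) : {pred Cplx R} :=
  fun z => `[< algebraic z >].

Lemma algebraicP (R : realType) (z : Cplx R) :
  reflect (algebraic z) (z \in @algebraic_pred R).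
Proof. exact: asboolP. Qed.

Lemma algebraic_divring_closed (R : realType) :
  divring_closed (@algebraic_pred R).
Proof.
split; first exact/algebraicP/algebraic1.
- by move=> y z /algebraicP Ay /algebraicP Az; apply/algebraicP/algebraic_sub.
- by move=> y z /algebraicP Ay /algebraicP Az; apply/algebraicP/algebraic_div.
Qed.

(** The algebraic numbers thereby form a subfield that can serve as the [S] of the interpolation
    lemma. *)
HB.instance Definition _ (R : realType) :=
  GRing.isDivringClosed.Build (Cplx R) (@algebraic_pred R)
    (@algebraic_divring_closed R).

Lemma ratr_algebraic (R : realType) (q : rat) :
  (ratr q : Cplx R) \in @algebraic_pred R.
Proof. exact/algebraicP/algebraic_id. Qed.

Lemma imaginary_unit_algebraic (R : realType) :
  ('i : Cplx R) \in @algebraic_pred R.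
Proof.
apply/algebraicP; exists ('X^2 + 1).
  rewrite monic_neq0 // monicE lead_coefDl ?lead_coefXn //.
  by rewrite size_polyXn size_poly1.
by rewrite rmorphD rmorph1 /= map_polyXn rootE !hornerE sqrCi addNr.
Qed.

(** Conjugation is a field morphism fixing the rationals, so it permutes the roots of a rational
    polynomial. *)
Lemma conj_algebraic (R : realType) (z : Cplx R) :
  z \in @algebraic_pred R -> z^* \in @algebraic_pred R.
Proof.
move=> /algebraicP[p p_neq0 pz0]; apply/algebraicP; exists p => //.
have -> : map_poly (ratr : rat -> Cplx R) p =
          map_poly Num.conj (map_poly (ratr : rat -> Cplx R) p).
  by rewrite -map_poly_comp; apply: eq_map_poly => q /=; rewrite fmorph_rat.
by rewrite fmorph_root.
Qed.

Lemma hdot_algebraic (R : realType) (N : nat) (v w : 'cV[Cplx R]_N) :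
  (forall j, v j 0 \in @algebraic_pred R) ->
  (forall j, w j 0 \in @algebraic_pred R) -> hdot v w \in @algebraic_pred R.
Proof.
by move=> Av Aw; apply: rpred_sum => j _; rewrite rpredM ?conj_algebraic.
Qed.

Lemma hdotZl (R : realType) (N : nat) (c : Cplx R) (v w : 'cV[Cplx R]_N) :
  hdot (c *: v) w = c * hdot v w.
Proof. by rewrite mulr_sumr; apply: eq_bigr => j _; rewrite mxE mulrA. Qed.

Lemma rational_point_algebraic (R : realType) (N : nat) (u : 'I_N -> bool)
    (x : 'cV[Cplx R]_N) :
  rational_point u x -> forall j, x j 0 \in @algebraic_pred R.
Proof.
move=> ratx j; have [q ->] := ratx j.
by rewrite rpredM ?rpredX ?imaginary_unit_algebraic ?ratr_algebraic.
Qed.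

(** The interpolant is ['X * q], where [q] is the Lagrange interpolant of the quotients [c i / y i];
    it is built by field operations alone, so its coefficients stay in [S]. *)
Lemma interpolation_no_constant_term (F : fieldType) (S : divringClosed F)
    (n : nat) (y c : 'I_n -> F) :
  injective y -> (forall i, y i != 0) ->
  (forall i, y i \in S) -> (forall i, c i \in S) ->
  exists2 a : 'I_n -> F, forall l, a l \in S &
    forall i, \sum_(l < n) a l * y i ^+ l.+1 = c i.
Proof.
move=> y_inj y_neq0 Sy Sc.
(* The Lagrange basis before normalization: [L i] vanishes at every node except [y i]. *)
pose L i := \prod_(k | k != i) ('X - (y k)%:P).
have Li_neq0 i : (L i).[y i] != 0.
  rewrite horner_prod; apply/prodf_neq0 => k ki.
  by rewrite hornerXsubC subr_eq0 (inj_eq y_inj) eq_sym.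
have Lk_eq0 i k : i != k -> (L k).[y i] = 0.
  by move=> ik; rewrite horner_prod (bigD1 i) //= hornerXsubC subrr mul0r.
have SL i : L i \is a polyOver S.
  by apply: rpred_prod => k _; rewrite polyOverXsubC.
(* Dividing by [(L i).[y i]] normalizes the basis; the further division by [y i] makes up for the
   factor ['X]. *)
pose q := \sum_i (c i / (y i * (L i).[y i])) *: L i.
have Sq : q \is a polyOver S.
  apply: rpred_sum => i _; apply: polyOverZ => //.
  by rewrite rpred_div ?rpredM ?rpred_horner.
have size_q : (size q <= n)%N.
  apply: (leq_trans (size_sum _ _ _)); apply/bigmax_leqP => i _.
  apply: (leq_trans (size_scale_leq _ _)).
  (* [L i] has [n.-1] linear factors, hence size [n.-1.+1]; this is [n] because the index [i] forces
     [n] to be positive. *)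
  rewrite /L -(big_enum _ _ (predC1 i)) size_prod_XsubC -cardE cardC1 card_ord.
  by rewrite prednK ?(leq_ltn_trans (leq0n i) (ltn_ord i)).
have q_y i : q.[y i] = c i / y i.
  rewrite horner_sum (bigD1 i) //= big1 ?addr0 => [|k ki].
    by rewrite hornerZ invfM mulrA mulfVK.
  by rewrite hornerZ (Lk_eq0 i) ?mulr0 // eq_sym.
(* The coefficient of ['X^l] in [q] is that of ['X^l.+1] in ['X * q]. *)
exists (fun l : 'I_n => q`_l) => [l|i]; first exact/polyOverP.
under eq_bigr do rewrite exprSr mulrA.
by rewrite -mulr_suml -horner_coef_wide // q_y divfK.
Qed.

Theorem theorem4p1 (R : realType) (N : nat) (N_ge3 : (3 <= N)%N)
    (G : set 'M[Cplx R]_N)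
    (G_inner : connected_real_inner_form G)
    (G_noncompact : ~ compact G)
    (v0 v1 : 'cV[Cplx R]_N)
    (v0_unit : unit_vector v0)
    (v0_inv : forall h, stab_e1 G h -> h *m v0 = v0)
    (v0_base : exists c : Cplx R, v0 = c *: e1 R N)
    (v0_alg : forall j, algebraic (v0 j 0))
    (v1_unit : unit_vector v1)
    (v1_hwv : highest_weight_vector (@first_fundamental_weight N) v1)
    (v1_alg : forall j, algebraic (v1 j 0))
    (psi1 : 'cV[Cplx R]_N -> Cplx R)
    (psi1E : forall g, G g -> psi1 (g *m e1 R N) = hdot (g *m v0) v1)
    (u : 'I_N -> bool) (u_realization : realization u)
    (n : nat) (x : 'I_n -> 'cV[Cplx R]_N)
    (x_orbit : forall i, orbit_e1 G (x i))
    (x_rational : forall i, rational_point u (x i))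
    (f : 'cV[Cplx R]_N -> rat)
    (f_nonconstant : exists i j, f (x i) <> f (x j))
    (psi1_neq0 : forall i, psi1 (x i) <> 0)
    (psi1_inj : forall i j : 'I_n, (i < j)%N -> psi1 (x i) <> psi1 (x j)) :
  exists a : 'I_n -> Cplx R,
    (forall l, algebraic (a l)) /\
    (forall i, \sum_(l < n) a l * psi1 (x i) ^+ l.+1 = ratr (f (x i))).
Proof.
have N_gt0 : (0 < N)%N by apply: leq_trans N_ge3.
have [c v0E] := v0_base.
(* [c] is the first coordinate of [v0]. *)
have Ac : c \in @algebraic_pred R.
  have /algebraicP := v0_alg (Ordinal N_gt0).
  by rewrite v0E !mxE eqxx mulr1.
have psi1_algebraic i : psi1 (x i) \in @algebraic_pred R.
  have Ax := rational_point_algebraic _ _ _ _ (x_rational i).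
  have [g Gg gE] := x_orbit i; rewrite -gE in Ax *.
  (* With [x i = g *m e1 R N], linearity turns [g *m v0] into [c *: x i], whose coordinates no
     longer involve the entries of [g] other than through [x i]. *)
  rewrite psi1E // v0E -scalemxAr hdotZl rpredM // hdot_algebraic // => j.
  exact/algebraicP.
have psi1_x_inj : injective (psi1 \o x).
  move=> i j /= eq_ij; apply/val_inj; have [ij|ji|//] := ltngtP i j.
    by case: (psi1_inj _ _ ij).
  by case: (psi1_inj _ _ ji).
(* The nodes are the values of [psi1], the targets those of [f]; the premise left open is that no
   node is zero. *)
have [i|a Aa aE] := interpolation_no_constant_term _ (@algebraic_pred R) _
  (psi1 \o x) (fun i => ratr (f (x i))) psi1_x_inj _ psi1_algebraic
  (fun i => ratr_algebraic _ _).
  exact/eqP/psi1_neq0.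
by exists a; split=> // l; apply/algebraicP.
Qed.
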